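(* Let $r\ge 2$ and $s\ge 1$ be integers. Then $$Q(x,t)=\frac{Z_{r-1}(x)-xZ_{r-2}(x)P(x,t)}{Z_{r}(x)-xZ_{r-1}(x)P(x,t)}.$$
   Context: For a word $w=w_1\cdots w_n$ of positive integers, its bargraph consists of $n$ consecutive columns of unit cells, aligned at the bottom, the $i$-th column having height $w_i$. For integers $\rho,s\ge1$, an occurrence of a $\rho\times s$ rectangle in $w$ is a placement of a rectangle of height $\rho$ and width $s$ (with sides along the unit grid) inside the bargraph. Equivalently, the number of occurrences is $\sum_{i=1}^{n-s+1}\max\{\min\{w_i,\ldots,w_{i+s-1}\}-\rho+1,0\}$ (which is $0$ if $n<s$). A Catalan word of length $n$ is a word $w_1\cdots w_n$ of positive integers with $w_1=1$ and $w_{i+1}\le w_i+1$ for all $1\le i\le n-1$; $\mathcal{C}_n$ is the set of Catalan words of length $n$ ($\mathcal{C}_0$ contains only the empty word). Let $p_n(t)=\sum_{w\in\mathcal{C}_n}t^{(\text{number of occurrences of } 1\times s\text{ rectangles in } w)}$, $q_n(t)=\sum_{w\in\mathcal{C}_n}t^{(\text{number of occurrences of } r\times s\text{ rectangles in } w)}$, $P(x,t)=\sum_{n\ge 0}p_n(t)x^n$ and $Q(x,t)=\sum_{n\ge 0}q_n(t)x^n$ (formal power series in $x$). The polynomials $Z_n(x)$ are defined by $Z_0(x)=0$, $Z_n(x)=\sqrt{x^{n-1}}\,U_{n-1}\left(\frac{1}{2\sqrt{x}}\right)$ for $n\ge 1$, where $U_n$ is the Chebyshev polynomial of the second kind ($U_0(x)=1$,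 $U_1(x)=2x$, $U_n(x)=2xU_{n-1}(x)-U_{n-2}(x)$ for $n\ge2$). Equivalently, $Z_0=0$, $Z_1=Z_2=1$, and $Z_n(x)=Z_{n-1}(x)-xZ_{n-2}(x)$ for $n\ge 3$. *)

(* Defs.v *)
From HB Require Import structures.
From mathcomp Require Import all_boot all_order all_algebra.
From mathcomp Require Import boolp.
From mathcomp Require Import zify ring.

Set Implicit Arguments.
Unset Strict Implicit.
Unset Printing Implicit Defensive.

Import Order.TTheory GRing.Theory Num.Theory.

Local Open Scope ring_scope.

(* Formal power series over R.  A record rather than a bare function type, so
   that the ring structure is the Cauchy product and not the pointwise one
   that functions into a ring carry in mathcomp-classical. *)
Record fps (R : Type) := Fps { fcoef : nat -> R }.

HB.instance Definition _ (R : Type) := gen_eqMixin (fps R).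
HB.instance Definition _ (R : Type) := gen_choiceMixin (fps R).

Lemma fpsP (R : Type) (f g : fps R) : fcoef f =1 fcoef g <-> f = g.
Proof.
split=> [|-> //]; case: f g => f [g] /= e.
by congr Fps; apply/funext.
Qed.

Section FpsRing.
Variable R : comNzRingType.
Implicit Types f g h : fps R.

Definition fps_zero : fps R := Fps (fun=> 0).
Definition fps_opp f : fps R := Fps (fun n => - fcoef f n).
Definition fps_add f g : fps R := Fps (fun n => fcoef f n + fcoef g n).

Fact fps_addA : associative fps_add.
Proof. by move=> f g h; apply/fpsP => n /=; rewrite addrA. Qed.
Fact fps_addC : commutative fps_add.
Proof. by move=> f g; apply/fpsP => n /=; rewrite addrC. Qed.
Fact fps_add0 : left_id fps_zero fps_add.
Proof. by move=> f; apply/fpsP => n /=; rewrite add0r. Qed.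
Fact fps_addN : left_inverse fps_zero fps_opp fps_add.
Proof. by move=> f; apply/fpsP => n /=; rewrite addNr. Qed.

HB.instance Definition _ :=
  GRing.isZmodule.Build (fps R) fps_addA fps_addC fps_add0 fps_addN.

Definition fps_of_poly (p : {poly R}) : fps R := Fps (fun n => p`_n).

Definition fps_one : fps R := fps_of_poly 1.
Definition fps_mul f g : fps R :=
  Fps (fun n => \sum_(i < n.+1) fcoef f i * fcoef g (n - i)).

Definition fps_trunc (m : nat) f : {poly R} := \poly_(i < m) fcoef f i.

Lemma fps_mul_poly f g (p q : {poly R}) n :
    (forall i, (i <= n)%N -> fcoef f i = p`_i) ->
    (forall i, (i <= n)%N -> fcoef g i = q`_i) ->
  forall i, (i <= n)%N -> fcoef (fps_mul f g) i = (p * q)`_i.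
Proof.
move=> fp gq i le_in; rewrite coefM /=; apply: eq_bigr => j _.
have := ltn_ord j => ltj.
rewrite fp ?gq //; first by lia.
by lia.
Qed.

Lemma fps_truncE n i f : (i <= n)%N -> fcoef f i = (fps_trunc n.+1 f)`_i.
Proof. by move=> le_in; rewrite coef_poly ltnS le_in. Qed.

Fact fps_mulA : associative fps_mul.
Proof.
move=> f g h; apply/fpsP => n.
have E u k := @fps_truncE n k u.
have Egh k := @fps_mul_poly g h _ _ n (E g) (E h) k.
have Efg k := @fps_mul_poly f g _ _ n (E f) (E g) k.
rewrite (fps_mul_poly (E f) Egh) // (fps_mul_poly Efg (E h)) //.
by rewrite mulrA.
Qed.

Fact fps_mulC : commutative fps_mul.
Proof.
move=> f g; apply/fpsP => n; have E u k := @fps_truncE n k u.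
by rewrite (fps_mul_poly (E f) (E g)) // (fps_mul_poly (E g) (E f)) // mulrC.
Qed.

Fact fps_mul1 : left_id fps_one fps_mul.
Proof.
move=> f; apply/fpsP => n; have E k := @fps_truncE n k f.
rewrite (@fps_mul_poly _ _ 1 _ n _ E) //.
by rewrite mul1r -E.
Qed.

Fact fps_mulDl : left_distributive fps_mul fps_add.
Proof.
move=> f g h; apply/fpsP => n /=; rewrite -big_split /=.
by apply: eq_bigr => i _; rewrite mulrDl.
Qed.

Fact fps_1neq0 : fps_one != 0.
Proof.
apply/eqP => /fpsP/(_ 0%N)/eqP.
by rewrite /= coef1 eqxx oner_eq0.
Qed.

HB.instance Definition _ := GRing.Zmodule_isComNzRing.Build (fps R)
  fps_mulA fps_mulC fps_mul1 fps_mulDl fps_1neq0.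

Lemma fcoef0 n : fcoef (0 : fps R) n = 0. Proof. by []. Qed.
Lemma fcoef1 n : fcoef (1 : fps R) n = (n == 0%N)%:R.
Proof. exact: coef1. Qed.
Lemma fcoefN f n : fcoef (- f) n = - fcoef f n. Proof. by []. Qed.
Lemma fcoefD f g n : fcoef (f + g) n = fcoef f n + fcoef g n.
Proof. by []. Qed.
Lemma fcoefB f g n : fcoef (f - g) n = fcoef f n - fcoef g n.
Proof. by []. Qed.
Lemma fcoefM f g n :
  fcoef (f * g) n = \sum_(i < n.+1) fcoef f i * fcoef g (n - i).
Proof. by []. Qed.
Lemma fcoef_sum I (r : seq I) (P : pred I) (F : I -> fps R) n :
  fcoef (\sum_(i <- r | P i) F i) n = \sum_(i <- r | P i) fcoef (F i) n.
Proof. by elim/big_rec2: _ => // i x y _ <-. Qed.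

Lemma fcoef_poly (p : {poly R}) n : fcoef (fps_of_poly p) n = p`_n.
Proof. by []. Qed.

Fact fps_of_poly_is_zmod_morphism : zmod_morphism fps_of_poly.
Proof. by move=> p q; apply/fpsP => n; rewrite fcoefB /= coefB. Qed.
Fact fps_of_poly_is_monoid_morphism : monoid_morphism fps_of_poly.
Proof. by split=> // p q; apply/fpsP => n; rewrite fcoefM /= coefM. Qed.

HB.instance Definition _ := GRing.isZmodMorphism.Build {poly R} (fps R)
  fps_of_poly fps_of_poly_is_zmod_morphism.
HB.instance Definition _ := GRing.isMonoidMorphism.Build {poly R} (fps R)
  fps_of_poly fps_of_poly_is_monoid_morphism.

Lemma fcoef_exp_lt f k n : fcoef f 0 = 0 -> (n < k)%N -> fcoef (f ^+ k) n = 0.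
Proof.
move=> f0; elim: k n => // k IHk n; rewrite ltnS => le_nk.
rewrite exprS fcoefM big_ord_recl f0 mul0r add0r big1 // => i _.
rewrite IHk ?mulr0 // lift0.
by have := ltn_ord i; lia.
Qed.

End FpsRing.

Section FpsUnitRing.
Variable R : comUnitRingType.
Implicit Types f g : fps R.

Definition fps_unit : {pred fps R} := [pred f | fcoef f 0 \is a GRing.unit].

(* With c the constant coefficient of f and h = 1 - c^-1 f, the inverse of f
   is c^-1 * (1 + h + h^2 + ...), and h^k has no term of degree below k. *)
Definition fps_inv f : fps R :=
  if fcoef f 0 \is a GRing.unit then
    let u := fps_of_poly ((fcoef f 0)^-1)%:P in
    Fps (fun n => fcoef (u * \sum_(k < n.+1) (1 - u * f) ^+ k) n)
  else f.

Fact fps_mulVf : {in fps_unit, left_inverse 1 fps_inv *%R}.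
Proof.
move=> f uf; rewrite inE in uf; rewrite mulrC.
rewrite /fps_inv uf; set u := fps_of_poly _; set h := 1 - u * f.
have h0 : fcoef h 0 = 0.
  by rewrite /h fcoefB fcoef1 fcoefM big_ord1 /= coefC eqxx mulVr // subrr.
apply/fpsP => n.
have trunc_eq i : (i <= n)%N ->
    fcoef (u * \sum_(k < i.+1) h ^+ k) i = fcoef (u * \sum_(k < n.+1) h ^+ k) i.
  move=> le_in; rewrite !fcoefM; apply: eq_bigr => j _; congr (_ * _).
  rewrite !fcoef_sum.
  rewrite (@big_ord_widen _ _ _ i.+1 n.+1 (fun k => fcoef (h ^+ k) (i - j))) //.
  rewrite big_mkcond; apply: eq_bigr => k _; case: ifP => // ltk.
  by rewrite fcoef_exp_lt //; lia.
transitivity (fcoef (f * (u * \sum_(k < n.+1) h ^+ k)) n).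
  rewrite [LHS]fcoefM [RHS]fcoefM; apply: eq_bigr => i _; congr (_ * _).
  exact: (trunc_eq _ (leq_subr i n)).
have -> : f * (u * \sum_(k < n.+1) h ^+ k) = 1 - h ^+ n.+1.
  rewrite mulrA [f * u]mulrC -[u * f](subKr 1) -/h.
  by rewrite -[1 in RHS](expr1n _ n.+1) subrXX; congr (_ * _);
    apply: eq_bigr => i _; rewrite expr1n mul1r.
by rewrite fcoefB fcoef_exp_lt ?subr0.
Qed.

Fact fps_unitPl f g : g * f = 1 -> fps_unit f.
Proof.
move=> /fpsP/(_ 0%N); rewrite fcoefM big_ord1 fcoef1 /= => gf1.
by apply/unitrPr; exists (fcoef g 0); rewrite mulrC.
Qed.

Fact fps_inv_out : {in [predC fps_unit], fps_inv =1 id}.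
Proof. by move=> f; rewrite !inE /fps_inv => /negPf ->. Qed.

HB.instance Definition _ := GRing.ComNzRing_hasMulInverse.Build (fps R)
  fps_mulVf fps_unitPl fps_inv_out.

Lemma fps_unitE f : (f \is a GRing.unit) = (fcoef f 0 \is a GRing.unit).
Proof. by []. Qed.

End FpsUnitRing.

Section Chebyshev.
Variable R : comNzRingType.

Fixpoint chebyU (n : nat) : {poly R} :=
  match n with
  | 0%N => 1
  | 1%N => 'X *+ 2
  | (m.+1 as n').+1 => 'X *+ 2 * chebyU n' - chebyU m
  end.

(* Z_n(x) = sqrt(x^(n-1)) U_(n-1)(1 / (2 sqrt x)), as a polynomial in x; the
   agreement with this closed form is zpoly_chebyU below. *)
Fixpoint zpoly (n : nat) : {poly R} :=
  match n with
  | 0%N => 0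
  | 1%N => 1
  | (m.+1 as n').+1 => zpoly n' - 'X * zpoly m
  end.

End Chebyshev.

Arguments chebyU : clear implicits.
Arguments zpoly : clear implicits.

Lemma zpoly_chebyU (R : rcfType) (x : R) (n : nat) : 0 < x ->
  (zpoly R n.+1).[x]
    = Num.sqrt (x ^+ n) * (chebyU R n).[(2 * Num.sqrt x)^-1].
Proof.
move=> x_gt0.
have sx k : Num.sqrt (x ^+ k) = Num.sqrt x ^+ k.
  elim: k => [|k IHk]; first by rewrite !expr0 sqrtr1.
  by rewrite !exprS sqrtrM ?IHk // ltW.
have xE : x = Num.sqrt x ^+ 2 by rewrite sqr_sqrtr // ltW.
have s_neq0 : Num.sqrt x != 0 by rewrite gt_eqF // sqrtr_gt0.
rewrite sx {1}xE; move: (Num.sqrt x) s_neq0 => y y0 {sx xE}.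
suff: (zpoly R n.+1).[y ^+ 2] = y ^+ n * (chebyU R n).[(2 * y)^-1] /\
  (zpoly R n.+2).[y ^+ 2] = y ^+ n.+1 * (chebyU R n.+1).[(2 * y)^-1] by case.
have zpoly_step (p a b : R) : y * p * a - y ^+ 2 * (p * b) =
    y * (y * p) * (((2 * y)^-1 + (2 * y)^-1) * a - b).
  by field; rewrite y0.
elim: n => [|n [IH1 IH2]].
  rewrite /= mulr0 subr0 !hornerE /=; split=> //.
  by field; rewrite y0.
split=> //.
have -> : (zpoly R n.+3).[y ^+ 2] =
    (zpoly R n.+2).[y ^+ 2] - y ^+ 2 * (zpoly R n.+1).[y ^+ 2].
  by rewrite -[zpoly R n.+3]/(zpoly R n.+2 - 'X * zpoly R n.+1) !hornerE.
have -> z : (chebyU R n.+2).[z] =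
    (z + z) * (chebyU R n.+1).[z] - (chebyU R n).[z].
  rewrite -[chebyU R n.+2]/('X *+ 2 * chebyU R n.+1 - chebyU R n).
  by rewrite !hornerE.
rewrite IH1 IH2.
rewrite [y ^+ n.+2]exprS [y ^+ n.+1]exprS.
exact: zpoly_step.
Qed.

Local Open Scope nat_scope.

Definition is_catalan (w : seq nat) : bool :=
  if w is x :: w' then
    [&& x == 1, all (leq 1) w & path (fun a b => b <= a.+1) x w']
  else true.

(* The set C_n: the letters of a Catalan word of length n are at most n, so
   it suffices to search the words over {0, ..., n} (see mem_catalan_words). *)
Definition catalan_words (n : nat) : seq (seq nat) :=
  [seq w <- [seq [seq nat_of_ord i | i <- t] | t : n.-tuple 'I_n.+1]
  | is_catalan w].

Lemma catalan_le_size w : is_catalan w -> all (fun x => x <= size w) w.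
Proof.
case: w => //= x w /and3P[/eqP-> _ pw].
suff H m : path (fun a b => b <= a.+1) m w ->
    all (fun y => y <= m + size w) w.
  by have := H _ pw; rewrite add1n => ->; rewrite ltnS.
elim: w m {pw} => //= y w IHw m /andP[le_ym /IHw].
move=> IH; apply/andP; split; first by lia.
by apply: sub_all IH => z; lia.
Qed.

Lemma mem_catalan_words n w :
  (w \in catalan_words n) = (size w == n) && is_catalan w.
Proof.
rewrite mem_filter andbC; apply: andb_id2r => cw.
apply/mapP/eqP => [[t _ ->]|sw]; first by rewrite size_map size_tuple.
have st : size (map (@inord n) w) == n by rewrite size_map sw.
exists (Tuple st); first by rewrite mem_enum.
rewrite /= -map_comp -[LHS]map_id; apply/eq_in_map => x xw /=.
rewrite inordK // ltnS -sw.
by move/allP: (catalan_le_size cw) => /(_ x xw).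
Qed.

Lemma catalan_words_uniq n : uniq (catalan_words n).
Proof.
rewrite filter_uniq // map_inj_uniq ?enum_uniq // => t1 t2 e.
by apply/val_inj; apply: (inj_map val_inj).
Qed.

(* The cell in (0-based) column c and row h belongs to the bargraph of w;
   columns c >= size w are empty, as nth then returns 0. *)
Definition in_bargraph (w : seq nat) (c h : nat) : bool := h < nth 0 w c.

(* The rectangle of height rho and width s with bottom left cell in column i
   and row j lies inside the bargraph of w. *)
Definition rect_at (rho s : nat) (w : seq nat) (i j : nat) : bool :=
  [forall a : 'I_s, forall b : 'I_rho, in_bargraph w (i + a) (j + b)].

Definition occ (rho s : nat) (w : seq nat) : nat :=
  #|[set p : 'I_(size w) * 'I_(\max_(h <- w) h) | rect_at rho s w p.1 p.2]|.

Lemma rect_at_bounded rho s w i j : 0 < rho -> 0 < s -> rect_at rho s w i j ->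
  i < size w /\ j < \max_(h <- w) h.
Proof.
move=> r0 s0 /forallP/(_ (Ordinal s0))/forallP/(_ (Ordinal r0)).
rewrite /in_bargraph /= !addn0 => lt_j.
have lt_i : i < size w.
  by rewrite ltnNge; apply/negP => le_i; rewrite nth_default in lt_j.
split=> //; apply: leq_trans lt_j _.
by apply: leq_bigmax_seq => //; apply: mem_nth.
Qed.

Lemma rect_atE rho s w i j : 0 < rho -> 0 < s -> rect_at rho s w i j =
  (j + rho <= \big[minn/nth 0 w i]_(i <= k < i + s) nth 0 w k).
Proof.
move=> r0 s0.
have minP m x0 (F : nat -> nat) (r : seq nat) :
    (m <= \big[minn/x0]_(k <- r) F k) = (m <= x0) && all (fun k => m <= F k) r.
  elim: r => [|k r IHr]; first by rewrite big_nil andbT.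
  by rewrite big_cons leq_min IHr /= andbCA.
rewrite minP; apply/idP/idP.
  move=> /forallP H.
  have {}H k : i <= k < i + s -> j + rho <= nth 0 w k.
    move=> ik; have lt_k : k - i < s by lia.
    have lt_r : rho.-1 < rho by lia.
    move/forallP: (H (Ordinal lt_k)) => /(_ (Ordinal lt_r)).
    rewrite /in_bargraph /= subnKC; last by lia.
    lia.
  rewrite H; last by lia.
  by apply/allP => k; rewrite mem_index_iota => /H.
move=> /andP[_ /allP H]; apply/forallP => a; apply/forallP => b.
have := ltn_ord a; have := ltn_ord b => lt_b lt_a.
have /H : i + a \in index_iota i (i + s) by rewrite mem_index_iota; lia.
rewrite /in_bargraph; lia.
Qed.

Lemma occE rho s w : 0 < rho -> 0 < s ->
  occ rho s w = \sum_(i < (size w).+1 - s)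
    ((\big[minn/nth 0 w i]_(i <= k < i + s) nth 0 w k).+1 - rho).
Proof.
move=> r0 s0; set M := fun i => \big[minn/nth 0 w i]_(i <= k < i + s) nth 0 w k.
have M_le i k : i <= k < i + s -> M i <= nth 0 w k.
  rewrite -mem_index_iota /M; elim: index_iota => //= a t IHt.
  rewrite big_cons inE geq_min => /orP[/eqP->|/IHt ->]; first by rewrite leqnn.
  by rewrite orbT.
transitivity (\sum_(i < size w) ((M i).+1 - rho)).
  transitivity (\sum_(i < size w)
      \sum_(j < \max_(h <- w) h | rect_at rho s w i j) 1).
    by rewrite pair_big_dep /= /occ -sum1_card; apply: eq_bigl => p; rewrite inE.
  apply: eq_bigr => i _.
  have le_M : (M i).+1 - rho <= \max_(h <- w) h.
    apply: (@leq_trans (M i)); first by lia.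
    apply: (leq_trans (M_le i i _)); first by lia.
    by apply: leq_bigmax_seq => //; apply: mem_nth.
  rewrite -[RHS]muln1 -[X in X * 1]card_ord -sum_nat_const.
  rewrite (big_ord_widen _ (fun _ => 1) le_M).
  apply: eq_bigl => j; rewrite rect_atE // -/(M i); lia.
rewrite (@big_ord_widen _ _ _ ((size w).+1 - s) (size w) (fun i => (M i).+1 - rho)); last by lia.
rewrite [RHS]big_mkcond; apply: eq_bigr => i _; case: ifP => // lt_i.
have := M_le i (i + s.-1); have := ltn_ord i => lt_iw.
rewrite nth_default; last by lia.
by lia.
Qed.

Local Open Scope ring_scope.

(* The coefficient ring is {poly int}, whose variable is t. *)
Definition catalan_occ_poly (rho s n : nat) : {poly int} :=
  \sum_(w <- catalan_words n) 'X ^+ occ rho s w.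

Definition catalan_occ_gf (rho s : nat) : fps {poly int} :=
  Fps (catalan_occ_poly rho s).

Definition Pgf (s : nat) : fps {poly int} := catalan_occ_gf 1 s.
Definition Qgf (r s : nat) : fps {poly int} := catalan_occ_gf r s.

Definition fpsX : fps {poly int} := fps_of_poly 'X.
Definition Zgf (n : nat) : fps {poly int} := fps_of_poly (zpoly {poly int} n).

(* Main.v *)
Require Import Defs.
From mathcomp Require Import all_boot all_order all_algebra.
From mathcomp Require Import zify ring.

Set Implicit Arguments.
Unset Strict Implicit.
Unset Printing Implicit Defensive.

Import GRing.Theory.
Local Open Scope ring_scope.

(** The identity comes from the first return decomposition of Catalan words.
    A nonempty Catalan word starts with [1]; the maximal block of letters
    greater than [1] right after it is a Catalan word [u] raised by one, and
    what remains is a Catalan word [v] (empty, or starting with [1]).  So [w = 1 (u + 1) v], and [(u, v)]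
    runs over all pairs of Catalan words ([catalan_sum_recl]).

    A rectangle of height [rho + 1 >= 2] cannot cover a column of height one.
    It therefore misses the first column and cannot straddle the border
    between [u + 1] and [v].  Removing the bottom cell of every column of
    [u + 1], and the bottom row of the rectangles inside it, leaves exactly the
    rectangles of height [rho] inside [u].  Hence
    [occ (rho + 1) w = occ rho u + occ (rho + 1) v] ([occ_catalan_join]), which
    in terms of generating functions says
    [Q_(rho + 1) = 1 + x Q_rho Q_(rho + 1)], i.e.
    [Q_(rho + 1) = 1 / (1 - x Q_rho)] ([catalan_occ_gf_rec]).

    Unfolding this from [Q_1 = P] gives a continued fraction, whose convergents
    are governed by the linear recurrence of the [Z_n].  With
    [D_r = Z_r - x Z_(r-1) P], that recurrence reads [D_(r+1) = D_r - x D_(r-1)],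
    and the claim is [Q_r = D_(r-1) / D_r]: the continued fraction step is
    [1 - x D_(r-1) / D_r = D_(r+1) / D_r].  Each [D_r] with [r >= 1] has constant
    term one, so it is invertible. *)

(** * Counting rectangles *)

Section Rectangles.
Local Open Scope nat_scope.

Lemma rect_atP rho s w i j : 0 < rho ->
  reflect (forall a, a < s -> j + rho <= nth 0 w (i + a)) (rect_at rho s w i j).
Proof.
move=> r0; apply: (iffP forallP) => [H a lt_as|H a].
  (* The top row of the rectangle decides whether it lies in the bargraph. *)
  have lt_r : rho.-1 < rho by rewrite prednK.
  move/forallP: (H (Ordinal lt_as)) => /(_ (Ordinal lt_r)).
  by rewrite /in_bargraph /=; lia.
apply/forallP => b; have := H a (ltn_ord a); have := ltn_ord b.
by rewrite /in_bargraph; lia.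
Qed.

(** With the range of the bottom row independent of the word, counts in
    different words can be compared position by position. *)
Lemma occ_sum rho s w M : 0 < rho -> 0 < s -> \max_(h <- w) h <= M ->
  occ rho s w = \sum_(0 <= i < size w) \sum_(0 <= j < M) rect_at rho s w i j.
Proof.
move=> r0 s0 le_M; rewrite big_mkord.
transitivity (\sum_(i < size w) \sum_(j < \max_(h <- w) h | rect_at rho s w i j) 1).
  by rewrite pair_big_dep /= /occ -sum1_card; apply: eq_bigl => p; rewrite inE.
apply: eq_bigr => i _; rewrite big_mkord.
rewrite (big_ord_widen_cond _ (fun j => rect_at rho s w i j) (fun _ => 1) le_M).
rewrite big_mkcond; apply: eq_bigr => j _.
case: (boolP (rect_at _ _ _ _ _)) => // /(rect_at_bounded r0 s0)[_ ->] //.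
Qed.

Lemma occ_nil rho s : occ rho s [::] = 0.
Proof. by rewrite /occ; apply: eq_card0 => -[[]]. Qed.

Lemma occ_cons rho s x w : 0 < s -> x < rho -> occ rho s (x :: w) = occ rho s w.
Proof.
move=> s0 lt_x; have r0 : 0 < rho by lia.
set M := \max_(h <- x :: w) h.
have le_w : \max_(h <- w) h <= M by rewrite /M big_cons leq_maxr.
rewrite (occ_sum r0 s0 (leqnn M)) (occ_sum r0 s0 le_w) /=.
rewrite big_nat_recl // big1_seq => [|j _]; last first.
  case: rect_atP => // /(_ 0 s0) /=; lia.
rewrite add0n; apply: eq_bigr => i _; apply: eq_bigr => j _.
by congr nat_of_bool; apply/rect_atP/rect_atP.
Qed.

(** A rectangle starting in [u] and leaving it would cover the first column
    of [v], which is too low. *)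
Lemma occ_cat rho s u v : 0 < s -> head 0 v < rho ->
  occ rho s (u ++ v) = occ rho s u + occ rho s v.
Proof.
move=> s0 lt_v; have r0 : 0 < rho by lia.
set M := \max_(h <- u ++ v) h.
have le_u : \max_(h <- u) h <= M by rewrite /M big_cat leq_maxl.
have le_v : \max_(h <- v) h <= M by rewrite /M big_cat leq_maxr.
rewrite (occ_sum r0 s0 (leqnn M)) (occ_sum r0 s0 le_u) (occ_sum r0 s0 le_v).
rewrite size_cat (big_cat_nat (leq0n _) (leq_addr _ _)) /=; congr (_ + _).
  apply: eq_big_nat => i /= lt_i; apply: eq_bigr => j _; congr nat_of_bool.
  apply/rect_atP/rect_atP => // H a lt_as; last first.
    rewrite nth_cat; have := H a lt_as.
    by case: ltnP => // /(nth_default 0) ->; lia.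
  have := H a lt_as; rewrite nth_cat; case: ltnP => // le_ua _.
  (* Column [size u] is the first one of [v]. *)
  have lt_b : size u - i < s by lia.
  have := H _ lt_b; rewrite subnKC; last by lia.
  by rewrite nth_cat ltnn subnn nth0; lia.
rewrite -{1}[size u]add0n big_addn addKn.
apply: eq_bigr => i _; apply: eq_bigr => j _; congr nat_of_bool.
by apply/rect_atP/rect_atP => // H a /H; rewrite nth_cat;
  (have -> : i + size u + a < size u = false by lia);
  (have -> : i + size u + a - size u = i + a by lia).
Qed.

Lemma occ_map_succ rho s u : 0 < rho -> 0 < s ->
  occ rho.+1 s (map S u) = occ rho s u.
Proof.
move=> r0 s0; set M := maxn (\max_(h <- u) h) (\max_(h <- map S u) h).
rewrite (occ_sum r0 s0 (leq_maxl _ _ : _ <= M)).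
rewrite (occ_sum (ltn0Sn rho) s0 (leq_maxr _ _ : _ <= M)) size_map.
apply: eq_bigr => i _; apply: eq_bigr => j _; congr nat_of_bool.
by apply/rect_atP/rect_atP => // H a /H; (case: (ltnP (i + a) (size u)) => lt_u;
  [rewrite (nth_map 0) // | rewrite !nth_default ?size_map //]); lia.
Qed.

End Rectangles.

(** * The first return decomposition of Catalan words *)

Section FirstReturn.
Local Open Scope nat_scope.

Definition catalan_join (u v : seq nat) : seq nat := 1 :: map S u ++ v.

Lemma occ_catalan_join rho s u v : 0 < rho -> 0 < s -> is_catalan v ->
  occ rho.+1 s (catalan_join u v) = occ rho s u + occ rho.+1 s v.
Proof.
move=> r0 s0 cv; rewrite occ_cons // occ_cat ?occ_map_succ //.
by case: v cv => //= x v /andP[/eqP->].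
Qed.

Lemma is_catalan_join u v : all (leq 1) u -> head 1 v <= 1 ->
  is_catalan (catalan_join u v) = is_catalan u && is_catalan v.
Proof.
move=> u1 hv; rewrite /= all_cat cat_path.
have -> : all (leq 1) (map S u) by apply/allP => _ /mapP[x _ ->].
have -> : path (fun a b => b <= a.+1) 1 (map S u) = is_catalan u.
  case: u u1 => //= x u /andP[x1 u1].
  rewrite x1 u1 path_map ltnS [RHS]/= eqn_leq x1 andbT.
  by congr andb; apply: eq_path.
case: v hv => [|x v] /=; first by rewrite andbT.
move=> x1; rewrite eqn_leq x1 /= (leq_trans x1) //.
by case: (0 < x) => //=; case: is_catalan => //=; rewrite andbF.
Qed.

Lemma catalan_pos w : is_catalan w -> all (leq 1) w.
Proof. by case: w => //= x w /and3P[_ ->]. Qed.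

Lemma catalan_head w : is_catalan w -> head 1 w <= 1.
Proof. by case: w => //= x w /andP[/eqP->]. Qed.

Lemma catalan_join_catalan u v :
  is_catalan u -> is_catalan v -> is_catalan (catalan_join u v).
Proof.
by move=> cu cv; rewrite is_catalan_join ?cu ?catalan_pos ?catalan_head.
Qed.

(** The block [u + 1] ends at the first letter of [w] after the initial one
    that is at most [1]. *)
Lemma catalan_joinP w : is_catalan w -> w != [::] ->
  exists u v, [/\ is_catalan u, is_catalan v & w = catalan_join u v].
Proof.
case: w => // x w cw _; have /eqP x1 : x == 1 by case/andP: cw.
set k := find (leq^~ 1) w.
have gt1 : all (leq 2) (take k w).
  apply/(all_nthP 0) => i; rewrite size_take_min leq_min => /andP[lt_ik _].
  by rewrite nth_take // ltnNge (before_find 0 lt_ik).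
have takeE : take k w = map S (map predn (take k w)).
  rewrite -map_comp -[LHS]map_id; apply/eq_in_map => y /(allP gt1) /=; lia.
have wE : x :: w = catalan_join (map predn (take k w)) (drop k w).
  by rewrite /catalan_join -takeE cat_take_drop x1.
exists (map predn (take k w)), (drop k w).
move: cw; rewrite {1}wE is_catalan_join => [/andP[cu cv]||//].
- by [].
- by rewrite all_map; apply: sub_all gt1 => y /=; lia.
rewrite -nth0 nth_drop addn0; have [hk|] := boolP (has (leq^~ 1) w).
  by rewrite (nth_find _ hk).
by move=> /hasNfind kE; rewrite nth_default // /k kE.
Qed.

Lemma catalan_join_inj u v u' v' : is_catalan v -> is_catalan v' ->
  all (leq 1) u -> all (leq 1) u' ->
  catalan_join u v = catalan_join u' v' -> u = u' /\ v = v'.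
Proof.
move=> cv cv' + + [].
elim: u u' => [|x u IHu] [|x' u'] //=.
- move=> _ /andP[x'1 _] e; move: cv; rewrite e /=; lia.
- move=> /andP[x1 _] _ e; move: cv'; rewrite -e /=; lia.
by move=> /andP[_ u1] /andP[_ u'1] [-> /(IHu _ u1 u'1)[-> ->]].
Qed.

Definition catalan_pairs (n : nat) : seq (seq nat * seq nat) :=
  [seq p | i <- iota 0 n.+1,
    p <- [seq (u, v) | u <- catalan_words i, v <- catalan_words (n - i)]].

Lemma mem_catalan_pairs n u v : ((u, v) \in catalan_pairs n) =
  [&& size u + size v == n, is_catalan u & is_catalan v].
Proof.
apply/allpairsPdep/and3P => [[i [_ [+ /allpairsP[[u' v'] [+ + ->]] [-> ->]]]] | []].
  rewrite mem_iota !mem_catalan_words /= => lt_i /andP[/eqP-> ->] /andP[/eqP-> ->].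
  by split=> //; lia.
move=> /eqP szE cu cv; exists (size u), (u, v); split=> //.
  by rewrite mem_iota; lia.
apply/allpairsP; exists (u, v); rewrite !mem_catalan_words cu cv; split=> //=.
  by rewrite eqxx.
by rewrite -szE addKn eqxx.
Qed.

Lemma catalan_pairs_uniq n : uniq (catalan_pairs n).
Proof.
apply: allpairs_uniq_dep => [|i _|]; first exact: iota_uniq.
  by apply: allpairs_uniq; rewrite ?catalan_words_uniq // => -[? ?] [? ?].
move=> _ _ /allpairsPdep[i [p [_ ip ->]]] /allpairsPdep[i' [p' [_ ip' ->]]] /= pp'.
move: ip ip'; rewrite -pp'.
move=> /allpairsP[q [+ _ ->]] /allpairsP[q' [+ _ [qq' _]]].
by rewrite -qq' !mem_catalan_words => /andP[/eqP<- _] /andP[/eqP<- _].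
Qed.

Lemma perm_catalan_words_succ n : perm_eq (catalan_words n.+1)
  [seq catalan_join p.1 p.2 | p <- catalan_pairs n].
Proof.
apply: uniq_perm; first exact: catalan_words_uniq.
  rewrite map_inj_in_uniq ?catalan_pairs_uniq // => -[u v] [u' v'].
  rewrite !mem_catalan_pairs => /and3P[_ cu cv] /and3P[_ cu' cv'] /=.
  by case/catalan_join_inj => //; rewrite ?catalan_pos // => -> ->.
have size_join u v : size (catalan_join u v) = (size u + size v).+1.
  by rewrite /= size_cat size_map.
move=> w; rewrite mem_catalan_words; apply/andP/mapP => [[/eqP sw cw]|].
  have [|u [v [cu cv wE]]] := catalan_joinP cw; first by case: (w) sw.
  exists (u, v) => //; rewrite mem_catalan_pairs cu cv !andbT.
  by move: sw; rewrite wE size_join => -[->].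
move=> [[u v] + ->]; rewrite mem_catalan_pairs => /and3P[/eqP<- cu cv].
by rewrite size_join eqxx catalan_join_catalan.
Qed.

End FirstReturn.

Lemma catalan_sum_recl (V : nmodType) (F : seq nat -> V) n :
  \sum_(w <- catalan_words n.+1) F w =
  \sum_(i < n.+1) \sum_(u <- catalan_words i) \sum_(v <- catalan_words (n - i))
    F (catalan_join u v).
Proof.
rewrite (perm_big _ (perm_catalan_words_succ n)) big_map big_allpairs_dep.
rewrite -[iota _ _]/(index_iota 0 n.+1) big_mkord.
by apply: eq_bigr => i _; rewrite big_allpairs.
Qed.

(** * Generating functions *)

Lemma catalan_occ_poly0 rho s : catalan_occ_poly rho s 0 = 1.
Proof.
have p0 : perm_eq (catalan_words 0) [:: [::]].
  apply: uniq_perm; rewrite ?catalan_words_uniq // => w.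
  by rewrite mem_catalan_words inE; case: w.
by rewrite /catalan_occ_poly (perm_big _ p0) big_seq1 occ_nil expr0.
Qed.

Lemma catalan_occ_poly_rec rho s n : (0 < rho)%N -> (0 < s)%N ->
  catalan_occ_poly rho.+1 s n.+1 =
  \sum_(i < n.+1) catalan_occ_poly rho s i * catalan_occ_poly rho.+1 s (n - i).
Proof.
move=> r0 s0; rewrite /catalan_occ_poly catalan_sum_recl.
apply: eq_bigr => i _; rewrite mulr_suml; apply: eq_bigr => u _.
rewrite mulr_sumr [LHS]big_seq [RHS]big_seq; apply: eq_bigr => v.
by rewrite mem_catalan_words => /andP[_ cv]; rewrite occ_catalan_join // exprD.
Qed.

Lemma fcoefXM (f : fps {poly int}) n :
  fcoef (fpsX * f) n = if n is m.+1 then fcoef f m else 0.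
Proof.
rewrite fcoefM big_ord_recl /= coefX mul0r add0r.
case: n => [|n]; first by rewrite big_ord0.
rewrite big_ord_recl /= coefX mul1r subn1 big1 ?addr0 // => i _.
by rewrite coefX mul0r.
Qed.

Lemma catalan_occ_gf_rec rho s : (0 < rho)%N -> (0 < s)%N ->
  catalan_occ_gf rho.+1 s =
  1 + fpsX * (catalan_occ_gf rho s * catalan_occ_gf rho.+1 s).
Proof.
move=> r0 s0; apply/fpsP => n; rewrite fcoefD fcoef1 fcoefXM.
case: n => [|n]; first by rewrite addr0 /= catalan_occ_poly0.
by rewrite add0r fcoefM /= catalan_occ_poly_rec.
Qed.

(** * The continued fraction *)

Lemma Zgf_rec n : Zgf n.+2 = Zgf n.+1 - fpsX * Zgf n.
Proof. by rewrite /Zgf /fpsX -rmorphM -rmorphB. Qed.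

Lemma Zgf_coef0 n : fcoef (Zgf n.+1) 0 = 1.
Proof.
elim: n => [|n IHn]; first by rewrite fcoef_poly coef1.
by rewrite Zgf_rec fcoefB IHn fcoefXM subr0.
Qed.

Lemma Zgf_denom_unit n (f : fps {poly int}) :
  Zgf n.+1 - fpsX * Zgf n * f \is a GRing.unit.
Proof.
by rewrite fps_unitE fcoefB -mulrA fcoefXM subr0 Zgf_coef0 unitr1.
Qed.

(** The equation [Q_r D_r = D_(r-1)] with [r = m + 2]; kept free of division,
    it follows by induction on [r]. *)
Lemma Qgf_mul_denom m s : (0 < s)%N ->
  Qgf m.+2 s * (Zgf m.+2 - fpsX * Zgf m.+1 * Pgf s) =
  Zgf m.+1 - fpsX * Zgf m * Pgf s.
Proof.
move=> s0.
have rec k : Qgf k.+2 s = 1 + fpsX * (Qgf k.+1 s * Qgf k.+2 s).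
  exact: catalan_occ_gf_rec.
elim: m => [|m IHm].
  have -> : Zgf 2 = 1 by rewrite Zgf_rec /Zgf /= rmorph0 rmorph1 mulr0 subr0.
  have -> : Zgf 1 = 1 by rewrite /Zgf rmorph1.
  have -> : Zgf 0 = 0 by rewrite /Zgf rmorph0.
  have e := rec 0%N; rewrite -[Qgf 1 s]/(Pgf s) in e.
  rewrite mulrBr mulr1 {1}e; ring.
have e := rec m.+1; move: e IHm; rewrite (Zgf_rec m.+1) (Zgf_rec m).
set Q := Qgf m.+2 s; set Q' := Qgf m.+3 s.
move: (Zgf m.+1) (Zgf m) (Pgf s) fpsX => a b p x e IH.
(* The goal is [Q' * (D - x * D') = D], where [IH] reads [Q * D = D']. *)
have -> : a - x * b - x * a - x * (a - x * b) * p =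
  (a - x * b - x * a * p) - x * (a - x * b * p) by ring.
rewrite -IH; set D := a - x * b - x * a * p.
have -> : Q' * (D - x * (Q * D)) = (Q' - x * (Q * Q')) * D by ring.
by rewrite {1}e addrK mul1r.
Qed.

Theorem theorem13 (r s : nat) (hr : (2 <= r)%N) (hs : (1 <= s)%N) :
  Zgf r - fpsX * Zgf (r - 1)%N * Pgf s \is a GRing.unit /\
  Qgf r s = (Zgf (r - 1)%N - fpsX * Zgf (r - 2)%N * Pgf s)
            / (Zgf r - fpsX * Zgf (r - 1)%N * Pgf s).
Proof.
case: r hr => [|[|m]] // _; rewrite !subSS !subn0.
have uD := Zgf_denom_unit m.+1 (Pgf s).
by split=> //; rewrite -Qgf_mul_denom // mulrK.
Qed.
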